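(* Let $N\geq 1$ and $L>0$. Suppose that $\mathcal{D}\subseteq\mathcal{S}^{N-1}$ and $|\mathcal{D}|\leq N$. Then $\mathcal{D}$ is not a proper quantization for the class $\mathcal{F}_L(\mathbb{R}^N)$.
   Context: $\|\cdot\|$ is the Euclidean norm, $\mathcal{S}^{N-1}$ is the unit sphere in $\mathbb{R}^N$, and $\mathrm{dist}(x,\mathcal{Y})=\inf_{v\in\mathcal{Y}}\|v-x\|$. Class $\mathcal{F}_L(\mathbb{R}^N)$: the set of functions $f:\mathbb{R}^N\to\mathbb{R}$ that are convex and differentiable with $L$-Lipschitz continuous gradient and whose set of minimizers $\mathcal{X}^\star=\arg\min_{x\in\mathbb{R}^N} f(x)$ is nonempty and bounded. Proper quantization: a finite set $\mathcal{D}\subseteq\mathcal{S}^{N-1}$ is a proper quantization for $\mathcal{F}_L(\mathbb{R}^N)$ if for every $f\in\mathcal{F}_L(\mathbb{R}^N)$ and every initialization $x(0)\in\mathbb{R}^N$ one can choose $d(t)\in\mathcal{D}$ and $\gamma(t)\in\mathbb{R}_+=[0,\infty)$ for all $t=0,1,2,\ldots$ such that the iterates $x(t+1)=x(t)-\gamma(t)d(t)$ satisfy $\lim_{t\to\infty}\mathrm{dist}(x(t),\mathcal{X}^\star)=0$. *)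

(* Defs.v *)
From HB Require Import structures.
From mathcomp Require Import all_boot all_order all_algebra.
From mathcomp Require Import all_classical all_reals all_analysis.

Set Implicit Arguments.
Unset Strict Implicit.
Unset Printing Implicit Defensive.

Import Order.TTheory GRing.Theory Num.Theory.
Import numFieldNormedType.Exports.

Local Open Scope classical_set_scope.
Local Open Scope ring_scope.

(* The library norm on ['rV[R]_N] is the max norm, so the Euclidean norm is
   defined separately and used wherever the choice of norm matters. The
   topology, hence [differentiable], is the same for both norms. *)
Definition enorm (R : realType) (N : nat) (x : 'rV[R]_N) : R :=
  Num.sqrt (\sum_(i < N) x ord0 i ^+ 2).

Definition unit_sphere (R : realType) (N : nat) : set 'rV[R]_N :=
  [set x | enorm x = 1].
Arguments unit_sphere : clear implicits.

Definition dist (R : realType) (N : nat) (x : 'rV[R]_N) (Y : set 'rV[R]_N) : R :=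
  inf [set enorm (v - x) | v in Y].

Definition gradient (R : realType) (N : nat) (f : 'rV[R]_N -> R)
    (x : 'rV[R]_N) : 'rV[R]_N :=
  \row_(i < N) 'D_(delta_mx ord0 i) f x.

Definition minimizers (R : realType) (N : nat) (f : 'rV[R]_N -> R) :
    set 'rV[R]_N :=
  [set x | forall y, f x <= f y].

Definition smooth_convex_class (R : realType) (N : nat) (L : R) :
    set ('rV[R]_N -> R) :=
  [set f : 'rV[R]_N -> R | [/\ convex_function [set: 'rV[R]_N] f,
      forall x, differentiable f x,
      forall x y, enorm (gradient f x - gradient f y) <= L * enorm (x - y),
      minimizers f !=set0
    & exists M : R, forall x, minimizers f x -> enorm x <= M]].

Definition proper_quantization (R : realType) (N : nat) (L : R)
    (D : set 'rV[R]_N) : Prop :=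
  [/\ finite_set D, D `<=` unit_sphere R N
    & forall f, smooth_convex_class L f -> forall x0 : 'rV[R]_N,
      exists (d : nat -> 'rV[R]_N) (gamma : nat -> R) (x : nat -> 'rV[R]_N),
        [/\ forall t, D (d t),
            forall t, 0 <= gamma t,
            x 0%N = x0,
            forall t, x t.+1 = x t - gamma t *: d t
          & dist (x t) (minimizers f) @[t --> \oo] --> (0 : R)]].

(* Main.v *)
Require Import Defs.
From HB Require Import structures.
From mathcomp Require Import all_boot all_order all_algebra.
From mathcomp Require Import all_classical all_reals all_analysis.
From mathcomp Require Import ring lra.

Set Implicit Arguments.
Unset Strict Implicit.
Unset Printing Implicit Defensive.

Import Order.TTheory GRing.Theory Num.Theory.
Import numFieldNormedType.Exports.

Local Open Scope classical_set_scope.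
Local Open Scope card_scope.
Local Open Scope ring_scope.

(** A set of at most [N] directions in dimension [N] lies in a closed
    half-space: there is a vector [p != 0] whose inner product with every
    direction is nonnegative ([exists_nonneg_direction]). A step
    [x - gamma *: d] with [gamma >= 0] can then never increase the inner product
    of [p] with the iterate, so iterates started at [- p] stay forever in the
    half-space where that product is at most [- enorm p ^+ 2]. This half-space
    is at distance [enorm p > 0] from the origin ([enorm_ge_halfspace]), hence
    the iterates cannot approach the minimizer of any function in the class
    that is minimized exactly at the origin. The quadratic
    [L / 2 * enorm x ^+ 2] is such a function: its gradient [L *: x] is
    [L]-Lipschitz with equality ([quadratic_smooth_convex]). *)

Lemma card_le_cover (T : choiceType) (A : set T) (n : nat) (t0 : T) :
  A #<= `I_n -> exists g : 'I_n -> T, A `<=` range g.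
Proof.
move=> /pcard_leP[f].
(* [t0] fills the indices outside the image of the injection [f]. *)
exists (fun i => xget t0 [set x | A x /\ f x = nat_of_ord i]) => x Ax.
have fx : (f x < n)%N by have := @funS _ _ _ _ f x Ax.
exists (Ordinal fx) => //.
case: xgetP => [y _ [Ay /= fyx]|/(_ x)[]//].
by apply: (@inj _ _ _ f) => //; rewrite inE.
Qed.

(** Put the vectors in the columns of a square matrix [A]; the inner products
    are the entries of [p *m A]. If [A] is invertible they can all be made equal
    to 1; if it is singular, a left null vector makes them all vanish. *)
Lemma exists_nonneg_direction (R : realFieldType) (N : nat)
    (g : 'I_N -> 'rV[R]_N) : (1 <= N)%N ->
  exists2 p : 'rV[R]_N, p != 0 &
    forall i, 0 <= \sum_(k < N) p ord0 k * g i ord0 k.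
Proof.
move=> N0; pose A : 'M[R]_N := \matrix_(k, i) g i ord0 k.
have dotE (p : 'rV[R]_N) i :
    \sum_(k < N) p ord0 k * g i ord0 k = (p *m A) ord0 i.
  by rewrite mxE; apply: eq_bigr => k _; rewrite mxE.
have [Au|] := boolP (A \in unitmx).
  exists (const_mx 1 *m invmx A) => [|i]; last first.
    by rewrite dotE mulmxKV// mxE.
  apply/eqP => /(congr1 (fun p => (p *m A) ord0 (Ordinal N0))).
  by rewrite mulmxKV// mul0mx !mxE => /eqP; rewrite oner_eq0.
rewrite unitmxE unitfE negbK => /det0P[p p0 pA]; exists p => // i.
by rewrite dotE pA mxE.
Qed.

Section quadratic.
Context {R : realType} {N : nat}.
Implicit Types (L : R) (x y v : 'rV[R]_N).

Definition quadratic L x : R := L / 2 * \sum_(i < N) x ord0 i ^+ 2.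

Lemma enorm_sqr x : enorm x ^+ 2 = \sum_(i < N) x ord0 i ^+ 2.
Proof. by rewrite sqr_sqrtr// sumr_ge0// => i _; exact: sqr_ge0. Qed.

Lemma enormZ (c : R) x : 0 <= c -> enorm (c *: x) = c * enorm x.
Proof.
move=> c0; rewrite /enorm; under eq_bigr do rewrite mxE exprMn.
by rewrite -mulr_sumr sqrtrM ?sqr_ge0// sqrtr_sqr ger0_norm.
Qed.

Lemma enorm0_eq0 x : enorm x = 0 -> x = 0.
Proof.
move=> x0; apply/rowP => i; rewrite mxE; apply/eqP; rewrite -sqrf_eq0.
have := enorm_sqr x; rewrite x0 expr0n/= => /esym/eqP.
by rewrite psumr_eq0 => [/allP/(_ i (mem_index_enum _))|j _]; rewrite ?sqr_ge0.
Qed.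

(** The pointwise sum becomes a sum in the ring of functions, which is the form
    handled by the differentiation rules. *)
Lemma quadraticE L : quadratic L =
  (L / 2) \*: (\sum_(i < N) (fun x : 'rV[R]_N => x ord0 i : R) ^+ 2).
Proof.
apply/funext => x /=; rewrite /quadratic fct_sumE; congr (_ * _).
Qed.

Lemma differentiable_quadratic L x : differentiable (quadratic L) x.
Proof.
rewrite quadraticE; apply: differentiableZ; apply: differentiable_sum => i.
by apply: differentiableX; exact: differentiable_coord.
Qed.

(** Entrywise reading of the fact that the derivative of the identity along [v]
    is [v]. *)
Lemma is_derive_coord (i : 'I_N) x v :
  is_derive x v (fun y : 'rV[R]_N => y ord0 i : R) (v ord0 i).
Proof.
apply: DeriveDef; first exact/diff_derivable/differentiable_coord.
have /(congr1 (fun M : 'rV[R]_N => M ord0 i)) :=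
  @derive_mx R _ _ _ id x v (@derivable_id _ _ x v).
by rewrite derive_id mxE.
Qed.

Lemma gradient_quadratic L x : gradient (quadratic L) x = L *: x.
Proof.
apply/rowP => j; rewrite !mxE quadraticE.
have H i := is_derive_coord i x (delta_mx ord0 j).
rewrite derive_val (bigD1 j)//= big1 => [|i ij].
  by rewrite !mxE !eqxx /= expr1 addr0 /GRing.scale /=; field.
by rewrite mxE eqxx (negbTE ij) scaler0.
Qed.

Lemma convex_quadratic L : 0 < L ->
  convex_function [set: 'rV[R]_N] (quadratic L).
Proof.
move=> L0 t x y _ _; rewrite convRE /quadratic.
have t0 : 0 <= t%:num by [].
have t1 : t%:num <= 1 by [].
rewrite !(mulrCA _ (L / 2)) -mulrDr ler_pM2l ?divr_gt0//.
rewrite !mulr_sumr -big_split/=; apply: ler_sum => i _.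
rewrite [conv t x y]/(t%:num *: x + (1 - t%:num) *: y) !mxE /unstable.onem.
have sqr_convex (s a b : R) : 0 <= s -> s <= 1 ->
    (s * a + (1 - s) * b) ^+ 2 <= s * a ^+ 2 + (1 - s) * b ^+ 2.
  move=> s0 s1; rewrite -subr_ge0.
  rewrite (_ : _ - _ = s * (1 - s) * (a - b) ^+ 2); last ring.
  by rewrite mulr_ge0 ?sqr_ge0 // mulr_ge0 ?subr_ge0.
exact: sqr_convex.
Qed.

Lemma minimizers_quadratic L : 0 < L ->
  minimizers (quadratic L) = [set (0 : 'rV[R]_N)].
Proof.
move=> L0.
have q0 : quadratic L 0 = 0.
  by rewrite /quadratic big1 ?mulr0// => i _; rewrite mxE expr0n.
have q_ge0 x : 0 <= quadratic L x.
  by rewrite mulr_ge0 ?divr_ge0 ?(ltW L0)// -enorm_sqr sqr_ge0.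
apply/seteqP; split=> [x xmin|_ -> y]; last by rewrite q0.
apply/enorm0_eq0/eqP; rewrite -sqrf_eq0 enorm_sqr.
have /eqP : quadratic L x = 0 by apply/le_anti; rewrite q_ge0 -q0 xmin.
by rewrite mulf_eq0 gt_eqF// divr_gt0.
Qed.

Lemma quadratic_smooth_convex L : 0 < L ->
  smooth_convex_class L (@quadratic L).
Proof.
move=> L0; split.
- exact: convex_quadratic.
- exact: differentiable_quadratic.
- by move=> x y; rewrite !gradient_quadratic -scalerBr enormZ ?(ltW L0).
- by exists 0; rewrite minimizers_quadratic.
- by exists (enorm (0 : 'rV[R]_N)) => x; rewrite minimizers_quadratic// => ->.
Qed.

End quadratic.

(** Expanding [0 <= enorm (p + x) ^+ 2] gives the bound without appealing to the
    Cauchy-Schwarz inequality. *)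
Lemma enorm_ge_halfspace (R : realType) (N : nat) (p x : 'rV[R]_N) :
  \sum_(k < N) p ord0 k * x ord0 k <= - enorm p ^+ 2 -> enorm p <= enorm x.
Proof.
move=> px; rewrite -(@ler_pXn2r _ 2) ?nnegrE ?sqrtr_ge0//.
have : 0 <= enorm (p + x) ^+ 2 by exact: sqr_ge0.
suff -> : enorm (p + x) ^+ 2 =
  enorm p ^+ 2 + enorm x ^+ 2 + 2 * \sum_(k < N) p ord0 k * x ord0 k by lra.
rewrite !enorm_sqr mulr_sumr -!big_split/=.
by apply: eq_bigr => k _; rewrite mxE; ring.
Qed.

Theorem theorem2 (R : realType) (N : nat) (hN : (1 <= N)%N) (L : R)
    (hL : 0 < L) (D : set 'rV[R]_N) (hD : D `<=` unit_sphere R N)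
    (hcard : D #<= `I_N) :
  ~ proper_quantization L D.
Proof.
move=> [_ _ /(_ _ (quadratic_smooth_convex hL)) DL].
have [g Dg] := card_le_cover 0 hcard.
have [p p0 pg] := exists_nonneg_direction g hN.
have [d [gamma [x [Dd gamma0 x0 xS]]]] := DL (- p).
have distE t : dist (x t) (minimizers (quadratic L)) = enorm (x t).
  rewrite minimizers_quadratic// /dist image_set1 inf1 sub0r.
  by rewrite /enorm; under eq_bigr do rewrite mxE sqrrN.
under eq_fun do rewrite distE.
have xp t : \sum_(k < N) p ord0 k * x t ord0 k <= - enorm p ^+ 2.
  elim: t => [|t IHt].
    rewrite x0 enorm_sqr -sumrN le_eqVlt; apply/orP; left.
    by apply/eqP/eq_bigr => k _; rewrite mxE; ring.
  have [i _ gi] := Dg _ (Dd t).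
  apply: le_trans IHt; rewrite -subr_ge0 -sumrB.
  rewrite (_ : \sum_(_ < _) _ =
      gamma t * \sum_(k < N) p ord0 k * g i ord0 k); first exact: mulr_ge0.
  rewrite mulr_sumr; apply: eq_bigr => k _; rewrite xS !mxE gi; ring.
move=> /cvgr_to_ge => /(_ (enorm p)) H.
have : enorm p <= 0 by apply: H; near=> t; exact: enorm_ge_halfspace.
apply/negP; rewrite -ltNge lt_def sqrtr_ge0 andbT.
by apply: contra p0 => /eqP/enorm0_eq0 ->.
Unshelve. all: by end_near. Qed.
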